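(* Let $k\ge1$ be an integer, let $V_1,\dots,V_k$ be pairwise disjoint nonempty finite sets (indices modulo $k$), and let $\overline V=\coprod_{i=1}^kV_i$. Let $P(\mathbf x)\in\mathbb Z[x_v:v\in\overline V]$ be the generating function, in target (vertex) variables, of the eventually constant representations on $(V_1,\dots,V_k)$ of the cyclic quiver with $k$ vertices. Then, in the field of fractions of $\mathbb Z[x_v:v\in\overline V]$, $$P(\mathbf x)=\mathbf e_1(\overline V)^{\overline{\mathbf V}^-}-2^k\,\mathbf e_1(\overline V)^{\overline{\mathbf V}^--\mathbf 2}\,\mathbf e_2(\overline V)^{\mathbf 1}.$$
   Context: The cyclic quiver has vertex set $\mathbb Z/k\mathbb Z$ and one arrow $i\to i+1$ for each $i$. A representation on $(V_1,\dots,V_k)$ is a $k$-tuple $W=(W_1,\dots,W_k)$ of functions $W_i:V_i\to V_{i+1}$, indices modulo $k$ (so $W_k:V_k\to V_1$). A transversal is a tuple $(c_1,\dots,c_k)$ with $c_i\in V_i$. $W$ is eventually constant if there is a transversal $(c_1,\dots,c_k)$ such that all sufficiently long cyclic compositions $W_{a+\ell}\circ\cdots\circ W_{a+1}\circ W_a$ have image contained in $\{c_1,\dots,c_k\}$. The generating function in target variables is $$P(\mathbf x)=\sum_{W\text{ eventually constant}}\ \prod_{i=1}^k\prod_{u\in V_i}x_{W_i(u)}.$$ For a finite set $S\subseteq V_i$ put $e_1(S)=\sum_{u\in S}x_u$ and $e_2(S)=\frac12\sum_{u,w\in S,\,u\ne w}x_ux_w$ (sum over ordered pairs, so $e_2$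 is the ordinary second elementary symmetric polynomial). Put $\mathbf e_1(\overline V)=(e_1(V_1),\dots,e_1(V_k))$, $\mathbf e_2(\overline V)=(e_2(V_1),\dots,e_2(V_k))$, $\overline{\mathbf V}=(|V_1|,\dots,|V_k|)$, and for a $k$-tuple $\mathbf c=(c_1,\dots,c_k)$ let $\mathbf c^-=(c_k,c_1,c_2,\dots,c_{k-1})$. Put $\mathbf 1=(1,\dots,1)$ and $\mathbf 2=(2,\dots,2)$. For a $k$-tuple $\mathbf q$ and $\mathbf c\in\mathbb Z^k$, $\mathbf q^{\mathbf c}=\prod_{i=1}^k q_i^{c_i}$ (all entries of $\mathbf q$ nonzero when negative exponents occur). Thus $\mathbf e_1(\overline V)^{\overline{\mathbf V}^-}=\prod_{i=1}^k e_1(V_i)^{|V_{i-1}|}$. *)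

(* Defs.v *)
From HB Require Import structures.
From mathcomp Require Import all_boot all_order all_algebra.
From mathcomp Require Import boolp.
From mathcomp Require Import fraction mpoly.

Set Implicit Arguments.
Unset Strict Implicit.
Unset Printing Implicit Defensive.

Import GRing.Theory.
Local Open Scope ring_scope.

Section CyclicQuiver.

Variables (k : nat) (V : 'I_k -> finType).

(* The coproduct of the V_i: working with a family of types makes the vertex
   sets disjoint. Indices are elements of 'I_k taken modulo k, through
   [ordS i] = i + 1 and [ord_pred i] = i - 1. *)
Definition vertex : finType := {i : 'I_k & V i}.

Definition vert (i : 'I_k) (u : V i) : vertex := Tagged V u.

Definition maps (i : 'I_k) : finType := {ffun V i -> V (ordS i)}.

Definition representation : finType := {dffun forall i : 'I_k, maps i}.

(* W_{a+l} o ... o W_{a+1} o W_a, a composition of l + 1 maps starting at V_a *)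
Fixpoint cyclic_comp (W : representation) (a : 'I_k) (l : nat) :
    V a -> V (iter l.+1 (@ordS k) a) :=
  match l return V a -> V (iter l.+1 (@ordS k) a) with
  | 0 => fun u => W a u
  | l'.+1 => fun u => W (iter l'.+1 (@ordS k) a) (cyclic_comp W l' u)
  end.

Definition eventually_constant (W : representation) : Prop :=
  exists c : forall i : 'I_k, V i, exists N : nat,
    forall l : nat, (N <= l)%N -> forall (a : 'I_k) (u : V a),
      exists i : 'I_k, vert (cyclic_comp W l u) = vert (c i).

(* Z[x_v : v in the coproduct]: [mpoly] numbers its variables, so vertices are
   numbered by [enum_rank]. *)
Definition vpoly := {mpoly int[#|vertex|]}.

Definition xvar (i : 'I_k) (u : V i) : vpoly := 'X_(enum_rank (vert u)).

Definition target_gf : vpoly :=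
  \sum_(W : representation | `[< eventually_constant W >])
    \prod_(i < k) \prod_(u : V i) xvar (W i u).

Definition vfrac := {fraction vpoly}.

Definition e1 (i : 'I_k) : vfrac := \sum_(u : V i) tofrac (xvar u).

Definition e2 (i : 'I_k) : vfrac :=
  2%:R^-1 * \sum_(u : V i) \sum_(w : V i | u != w) tofrac (xvar u) * tofrac (xvar w).

End CyclicQuiver.

Definition tuple_exp (F : fieldType) (k : nat) (q : 'I_k -> F)
    (c : 'I_k -> int) : F := \prod_(i < k) q i ^ c i.

(* c^- = (c_k, c_1, ..., c_{k-1}) *)
Definition shift_down (k : nat) (A : Type) (c : 'I_k -> A) : 'I_k -> A :=
  fun i => c (ord_pred i).

Definition sizes (k : nat) (V : 'I_k -> finType) : 'I_k -> int :=
  fun i => Posz #|V i|.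

(* Main.v *)
Require Import Defs.
From HB Require Import structures.
From mathcomp Require Import all_boot all_order all_fingroup all_algebra.
From mathcomp Require Import boolp.
From mathcomp Require Import fraction mpoly.
From mathcomp Require Import ring.

Set Implicit Arguments.
Unset Strict Implicit.
Unset Printing Implicit Defensive.

Import GRing.Theory.
Local Open Scope ring_scope.

(** Read the weights as probabilities: divide [x_v] by the sum [e1] of its
    fibre, so that a random representation sends each vertex of [V_i] independently
    to a random vertex of [V_(i+1)]. The right-hand side of the theorem is then
    the total weight times [1 - prod_i q_i], where [q_i = 2 e2 / e1^2] is the
    probability that two independent samples of [V_i] differ.

    A representation is the same thing as a map [f] of the disjoint union of the
    [V_i] to itself that sends fibre [i] into fibre [i + 1], and it is
    eventually constant exactly when some section [c] (one vertex [c i] per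
    fibre) is stable under [f] and attracts every vertex; such a [c] is unique.
    So the sum splits according to [c] ([ev_const_gf]). For a fixed [c] one
    needs the weight of the maps for which [c] is a cycle and all other vertices
    flow into [c].
    This is a sum over rooted forests, and a version of the matrix-tree theorem
    ([forest_theorem]) turns it into a determinant.

    That determinant is computable because the weight of an arc depends only on
    its target: after division of the rows by their total weights, the matrix is
    the identity minus a matrix that factors through the [k] fibres, so that
    Sylvester's identity ([fdet_sylvester]) reduces it to the [k] by [k]
    determinant of a weighted cycle, which is [1 - prod_i (1 - y_i)] with
    [y_i = x_(c i) / e1(V_i)] ([fdet_cycle], once more by [forest_theorem]).
    The contribution of [c] is thus [prod_i y_i * (1 - prod_i (1 - y_i))]
    ([cycle_core_gf]). Summed over all [c], with one independent choice in each
    fibre, this gives [1 - prod_i (1 - sum_u (x_u / e1)^2)], and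
    [e1^2 - sum_u x_u^2 = 2 e2]. *)

(** * Determinants indexed by finite types *)

(** Indexing by a finite type lets vertices of a graph label rows and columns
    directly. *)
Definition fdet (R : comNzRingType) (I : finType) (G : I -> I -> R) : R :=
  \det (\matrix_(p < #|I|, q < #|I|) G (enum_val p) (enum_val q)).

Lemma big_enum_rank (R : Type) (idx : R) (op : Monoid.com_law idx) (I : finType)
    (H : 'I_#|I| -> R) :
  \big[op/idx]_p H p = \big[op/idx]_u H (enum_rank u).
Proof. exact: reindex (onW_bij _ (@enum_rank_bij I)). Qed.

Lemma eq_fdet (R : comNzRingType) (I : finType) (G H : I -> I -> R) :
  (forall u v, G u v = H u v) -> fdet G = fdet H.
Proof. by move=> GH; congr (\det _); apply/matrixP => p q; rewrite !mxE. Qed.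

Lemma fdetE (R : comNzRingType) (I : finType) (G : I -> I -> R) :
  fdet G = \sum_(s : 'S_#|I|)
    (-1) ^+ s * \prod_u G u (enum_val (s (enum_rank u))).
Proof.
apply: eq_bigr => s _; congr (_ * _); rewrite big_enum_rank.
by apply: eq_bigr => u _; rewrite mxE enum_rankK.
Qed.

(** Multilinearity in all rows at once: expanding each row [u] as a combination
    over [j] produces one term for each choice function [f]. *)
Lemma fdet_expand_rows (R : comNzRingType) (I J : finType) (a : I -> J -> R)
    (B : I -> J -> I -> R) :
  fdet (fun u v => \sum_j a u j * B u j v) =
  \sum_(f : {ffun I -> J}) (\prod_u a u (f u)) * fdet (fun u v => B u (f u) v).
Proof.
rewrite fdetE; under eq_bigr do rewrite bigA_distr_bigA mulr_sumr.
rewrite exchange_big /=; apply: eq_bigr => f _.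
rewrite fdetE mulr_sumr; apply: eq_bigr => s _.
by rewrite big_split /= mulrCA.
Qed.

Lemma fdet_scale_rows (R : comNzRingType) (I : finType) (d : I -> R)
    (G : I -> I -> R) :
  fdet (fun u v => d u * G u v) = (\prod_u d u) * fdet G.
Proof.
rewrite !fdetE mulr_sumr; apply: eq_bigr => s _.
by rewrite big_split /= mulrCA.
Qed.

(** Sylvester's identity [det (1 - UV) = det (1 - VU)], by
    multiplying the block matrix with blocks [1, U, V, 1] on either side by the
    unitriangular one with blocks [1, 0, -V, 1]. *)
Lemma fdet_sylvester (R : comNzRingType) (I K : finType)
    (U : I -> K -> R) (V : K -> I -> R) :
  fdet (fun u v => (u == v)%:R - \sum_i U u i * V i v) =
  fdet (fun i j => (i == j)%:R - \sum_u V i u * U u j).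
Proof.
pose A := \matrix_(p < #|I|, q < #|K|) U (enum_val p) (enum_val q).
pose B := \matrix_(p < #|K|, q < #|I|) V (enum_val p) (enum_val q).
have sumE (L : finType) (H : L -> R) :
    \sum_u H u = \sum_(p < #|L|) H (enum_val p).
  by rewrite (reindex _ (onW_bij _ (@enum_val_bij L))).
transitivity (\det (1%:M - A *m B)).
  congr (\det _); apply/matrixP => p q.
  rewrite !mxE (inj_eq enum_val_inj) (sumE K).
  by congr (_ - _); apply: eq_bigr => r _; rewrite !mxE.
transitivity (\det (1%:M - B *m A)); last first.
  congr (\det _); apply/matrixP => p q.
  rewrite !mxE (inj_eq enum_val_inj) (sumE I).
  by congr (_ - _); apply: eq_bigr => r _; rewrite !mxE.
pose M := block_mx 1%:M A B 1%:M.
have e1 : M *m block_mx 1%:M 0 (- B) 1%:M = block_mx (1%:M - A *m B) A 0 1%:M.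
  by rewrite mulmx_block !mulmx1 !mul1mx !mulmx0 !mulmxN !add0r subrr.
have e2 : block_mx 1%:M 0 (- B) 1%:M *m M = block_mx 1%:M A 0 (1%:M - B *m A).
  by rewrite mulmx_block !mulmx1 !mul1mx !mul0mx !mulNmx !addr0 addNr addrC.
have := congr1 determinant e1; have := congr1 determinant e2.
by rewrite !det_mulmx !det_ublock !det_lblock !det1 !mulr1 !mul1r => -> ->.
Qed.

(** * The forest theorem *)

(** [None] stands for leaving the graph, so an acyclic partial map is a forest
    whose roots are the points sent to [None]. *)
Definition acyclic (I : Type) (g : I -> option I) : Prop :=
  forall u, exists m, iter m (obind g) (Some u) = None.

Lemma iter_obind_None (I : Type) (g : I -> option I) m :
  iter m (obind g) None = None.
Proof. by elim: m => //= m ->. Qed.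

(** If some points never leave, their indicator function is a kernel vector.
    If all points leave, only the identity contributes to the Leibniz formula:
    a permutation moving [u] with nonzero contribution would have to agree with
    [g] along its whole orbit of [u], which would then never leave. *)
Lemma fdet_partial_fun (R : idomainType) (I : finType) (g : I -> option I) :
  fdet (fun u v => (u == v)%:R - (g u == Some v)%:R) = `[< acyclic g >]%:R :> R.
Proof.
case: asboolP => [acg | ncg] /=; last first.
  pose z u := `[< forall m, iter m (obind g) (Some u) <> None >].
  have zg u : z u = if g u is Some v then z v else false.
    case gu: (g u) => [v|].
      apply: asbool_equiv_eq; split=> [zu m | zv [//|m]].
        by have := zu m.+1; rewrite iterSr /= gu.
      by rewrite iterSr /= gu; apply: zv.
    by apply: asboolF => /(_ 1%N) /=; rewrite gu.
  have [u0 zu0] : exists u, z u.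
    apply: contrapT => nz; apply: ncg => u; apply: contrapT => nm.
    by apply: nz; exists u; apply/asboolP => m um; apply: nm; exists m.
  apply/eqP; rewrite /fdet -det_tr; apply/det0P.
  exists (\row_p (z (enum_val p))%:R).
    apply/eqP => /rowP /(_ (enum_rank u0)) /eqP.
    by rewrite !mxE enum_rankK zu0 oner_eq0.
  apply/rowP => q; rewrite !mxE big_enum_rank.
  under eq_bigr do rewrite !mxE enum_rankK mulrBr.
  rewrite sumrB (bigD1 (enum_val q)) //= eqxx mulr1 big1 ?addr0; last first.
    by move=> u /negbTE nu; rewrite eq_sym nu mulr0.
  rewrite zg; case gq: (g (enum_val q)) => [v|].
    rewrite (bigD1 v) //= eqxx mulr1 big1 ?addr0 ?subrr // => u /negbTE nu.
    by rewrite (inj_eq Some_inj) eq_sym nu mulr0.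
  by rewrite big1 ?subrr // => u _; rewrite mulr0.
rewrite fdetE (bigD1 (1%g : 'S_#|I|)) //= [X in _ + X]big1 ?addr0.
  rewrite odd_perm1 mul1r big1 // => u _; rewrite perm1 enum_rankK eqxx.
  case: eqP => [gu|]; last by rewrite subr0.
  have [m] := acg u; suff -> : iter m (obind g) (Some u) = Some u by [].
  by elim: m => //= m ->.
move=> s /eqP s1; pose t u := enum_val (s (enum_rank u)).
have [u tu] : exists u, t u != u.
  apply: contrapT => nt; apply: s1; apply/permP => p; rewrite perm1.
  apply: enum_val_inj; apply/eqP; apply/negPn/negP => np; apply: nt.
  by exists (enum_val p); rewrite /t enum_valK.
have t_inj : injective t by move=> x y /enum_val_inj/perm_inj/enum_rank_inj.
have [w tw gw] : exists2 w, t w != w & g w != Some (t w).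
  apply: contrapT => nw.
  have [m] := acg u.
  suff [-> _] : iter m (obind g) (Some u) = Some (iter m t u)
      /\ t (iter m t u) != iter m t u by [].
  elim: m => [//|m [/= -> tm]]; split; last by rewrite (inj_eq t_inj).
  by apply/eqP/negPn/negP => ng; apply: nw; exists (iter m t u).
rewrite (bigD1 w) //= -/(t w) eq_sym (negbTE tw) (negbTE gw) subrr.
by rewrite mul0r mulr0.
Qed.

(** A weighted matrix-tree theorem. The index [j] is the choice made at [u],
    with weight [a u j] and with outcome [t u j]; separating choices from
    outcomes allows several choices to leave the graph. Expanding the rows
    leaves one determinant for each choice function, which is 0 or 1. *)
Lemma forest_theorem (R : idomainType) (I J : finType) (a : I -> J -> R)
    (t : I -> J -> option I) :
  fdet (fun u v => \sum_j a u j * ((u == v)%:R - (t u j == Some v)%:R)) =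
  \sum_(f : {ffun I -> J} | `[< acyclic (fun u => t u (f u)) >])
    \prod_u a u (f u).
Proof.
rewrite (fdet_expand_rows a (fun u j v => (u == v)%:R - (t u j == Some v)%:R)).
rewrite [RHS]big_mkcond /=; apply: eq_bigr => f _.
rewrite (fdet_partial_fun _ (fun u => t u (f u))).
by case: asbool; rewrite ?mulr1 ?mulr0.
Qed.

(** * The determinant of a weighted cycle *)

Lemma iter_ordS k m (i : 'I_k) : iter m (@ordS k) i = ((i + m) %% k)%N :> nat.
Proof.
elim: m => [|m IHm]; first by rewrite addn0 modn_small.
by rewrite iterS /= IHm -addn1 modnDml addn1 addnS.
Qed.

Lemma ordS_connected k (i j : 'I_k) : exists m, iter m (@ordS k) i = j.
Proof.
exists (k - i + j)%N; apply: ord_inj; rewrite iter_ordS addnA.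
by rewrite (subnKC (ltnW (ltn_ord i))) modnDl modn_small.
Qed.

Lemma iter_ordS_period k m (i : 'I_k) : iter (m * k) (@ordS k) i = i.
Proof.
by apply: ord_inj; rewrite iter_ordS addnC modnMDl modn_small.
Qed.

(** At each [i] toss a coin: step to [i + 1] with weight [r (i + 1)], leave with
    the complementary weight. The walk leaves from every point unless no coin
    says to leave, so the forest theorem gives the total weight 1 minus the
    weight of that single outcome, and no sign of a cyclic permutation has to
    be computed. *)
Lemma fdet_cycle (R : idomainType) k (i0 : 'I_k) (r : 'I_k -> R) :
  fdet (fun i j => (i == j)%:R - (ordS i == j)%:R * r j) = 1 - \prod_j r j.
Proof.
pose a i (b : bool) := if b then r (ordS i) else 1 - r (ordS i).
pose t (i : 'I_k) (b : bool) := if b then Some (ordS i) else None.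
transitivity (fdet (fun i j =>
    \sum_b a i b * ((i == j)%:R - (t i b == Some j)%:R))).
  apply: eq_fdet => i j; rewrite big_bool /= (inj_eq Some_inj).
  by case: (ordS i =P j) => [->|_]; rewrite /=; ring.
have prod_t : \prod_j r j = \prod_i a i ([ffun=> true] i).
  rewrite (reindex _ (onW_bij _ (@ordS_bij k))).
  by apply: eq_bigr => i _; rewrite ffunE.
rewrite forest_theorem prod_t.
have sum1 : \sum_(f : {ffun 'I_k -> bool}) \prod_i a i (f i) = 1.
  rewrite -bigA_distr_bigA big1 // => i _.
  by rewrite big_bool /= addrC subrK.
rewrite -[X in _ = X - _]sum1 [in RHS](bigD1 [ffun=> true]) //= addrC addrK.
apply: eq_bigl => f; apply/asboolP/idP => [acf | nf i].
  apply/eqP => ft; have [m] := acf i0.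
  suff -> : iter m (obind (fun i => t i (f i))) (Some i0) =
      Some (iter m (@ordS k) i0) by [].
  by elim: m => //= m ->; rewrite /= ft ffunE.
have [j fj] : exists j, f j = false.
  apply: contrapT => nj; case/eqP: nf; apply/ffunP => j; rewrite ffunE.
  by case fj: (f j) => //; case: nj; exists j.
have [m mj] := ordS_connected i j; exists m.+1 => /=.
set g := fun _ => _.
have : iter m (obind g) (Some i) = None
    \/ iter m (obind g) (Some i) = Some (iter m (@ordS k) i).
  elim: m {mj} => [|m [/= ->|/= ->]]; [by right | by left |].
  by rewrite /= /g; case: (f _); [right | left].
by case=> -> //=; rewrite mj /g fj.
Qed.

(** * Maps cycling through the fibres of a finite set *)

Section GradedMaps.

Variables (F : fieldType) (k : nat) (i0 : 'I_k) (T : finType) (tg : T -> 'I_k).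

Definition graded (f : {ffun T -> T}) : bool :=
  [forall v, tg (f v) == ordS (tg v)].

Definition sections := family (fun i : 'I_k => [pred v | tg v == i]).

Definition hits (c : 'I_k -> T) (v : T) : bool := c (tg v) == v.

Definition kill (c : 'I_k -> T) (v : T) : option T :=
  if hits c v then None else Some v.

(** Leaving the graph on arrival at [c], instead of at departure from it, gives
    the points of [c] an outgoing arc of their own, whose weight is counted. *)
Definition cycle_core (c : 'I_k -> T) (f : T -> T) : Prop :=
  (forall v, hits c v -> hits c (f v)) /\ acyclic (fun v => kill c (f v)).

Definition ev_const (c : 'I_k -> T) (f : T -> T) : Prop :=
  exists N, forall l, (N <= l)%N -> forall v, hits c (iter l.+1 f v).

Lemma tag_iter (f : {ffun T -> T}) m v :
  graded f -> tg (iter m f v) = iter m (@ordS k) (tg v).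
Proof. by move=> /forallP gf; elim: m => //= m <-; apply/eqP. Qed.

Lemma iter_kill_hits c (f : T -> T) m v : hits c (iter m.+1 f v) ->
  iter m.+1 (obind (fun v => kill c (f v))) (Some v) = None.
Proof.
set g := fun v => _; elim: m v => [|m IHm] v.
  by rewrite /= /g /kill => ->.
rewrite iterSr [iter m.+2 _ _]iterSr [obind g _]/(g v) /g /kill -/g.
by case: ifP => _; [rewrite iter_obind_None | exact: IHm].
Qed.

Lemma iter_hits c (f : T -> T) m v :
  (forall v, hits c v -> hits c (f v)) -> hits c v -> hits c (iter m f v).
Proof. by move=> cf cv; elim: m => //= m; apply: cf. Qed.

Lemma iter_kill_hitsV c (f : T -> T) m v :
  (forall v, hits c v -> hits c (f v)) ->
  iter m (obind (fun v => kill c (f v))) (Some v) = None -> hits c (iter m f v).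
Proof.
move=> cf; set g := fun v => _; elim: m v => // m IHm v.
rewrite !iterSr [obind g _]/(g v) /g /kill -/g.
by case: ifP => [cfv _|_]; [apply: iter_hits | apply: IHm].
Qed.

Lemma iter_period_hits c (f : {ffun T -> T}) m v : graded f ->
  hits c v -> hits c (iter (m * k) f v) -> iter (m * k) f v = v.
Proof.
move=> gf /eqP cv /eqP; rewrite tag_iter // iter_ordS_period => <-; exact: cv.
Qed.

Lemma ev_const_period c (f : T -> T) N v :
  (forall l, (N <= l)%N -> forall v, hits c (iter l.+1 f v)) ->
  hits c (iter (N.+1 * k) f v).
Proof.
have k_gt0 : (0 < k)%N by case: (k) i0 => [[]|].
have le_N : (N < N.+1 * k)%N by rewrite leq_pmulr.
by move=> cN; rewrite -(ltn_predK le_N) cN // -ltnS (ltn_predK le_N).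
Qed.

(** A graded map that is eventually in [c] permutes [c] cyclically, because
    iterates over a multiple of the period return to the fibre they started
    from, where [c] has one point. Conversely, stability of [c] makes the first
    hit permanent, and finiteness bounds the time of the first hit. *)
Lemma cycle_coreP c (f : {ffun T -> T}) : graded f ->
  cycle_core c f <-> ev_const c f.
Proof.
move=> gf; split=> [[cf acf] | [N cN]].
  have [m cm] := fin_all_exists acf.
  exists (\sum_v m v)%N => l le_l v.
  have le_m : (m v <= l.+1)%N.
    by rewrite (leq_trans _ (leqW le_l)) // (bigD1 v) //= leq_addr.
  by rewrite -(subnK le_m) iterD; apply: iter_hits => //; apply: iter_kill_hitsV.
split=> [v cv | v]; last by exists N.+1; apply: iter_kill_hits; apply: cN.
have k_gt0 : (0 < k)%N by case: (k) i0 => [[]|].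
(* A point of the section equals its own iterate over a long multiple of the
   period, so its image is a long iterate too. *)
rewrite -{1}(iter_period_hits gf cv (ev_const_period v cN)) -iterS; apply: cN.
by rewrite ltnW // leq_pmulr.
Qed.

Lemma hits_section c i : c \in sections -> hits c (c i).
Proof. by move=> /familyP /(_ i) /eqP tc; rewrite /hits tc. Qed.

(** Take a long iterate, over a multiple of the period, at [c' i]: it returns to
    [c' i], since [c'] is a cycle of [f], and it lies in [c]. *)
Lemma ev_const_inj c c' (f : {ffun T -> T}) : graded f ->
  c \in sections -> c' \in sections ->
  ev_const c f -> ev_const c' f -> c = c'.
Proof.
move=> gf sc sc' ef ef'; apply/ffunP => i.
have [N cN] := ef; have [cf' _] := (cycle_coreP c' gf).2 ef'.
have c'i := hits_section i sc'.
have := iter_period_hits gf c'i (iter_hits (N.+1 * k) cf' c'i).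
have := ev_const_period (c' i) cN.
move=> cc' eq_c'; move: cc'; rewrite eq_c' /hits.
by have /familyP/(_ i)/eqP -> := sc' => /eqP.
Qed.

Variable X : T -> F.

Definition fiber_sum (i : 'I_k) : F := \sum_(v | tg v == i) X v.

Hypothesis fiber_sum_neq0 : forall i, fiber_sum i != 0.

(** The forest theorem for the arcs of the graph that keep [c] stable. In the
    resulting matrix the rows of the points of [c] are diagonal; dividing each
    row by its total weight [d] leaves the identity minus [UV], where [U]
    records the fibre of a point outside [c], and [V] the distribution of its
    image, killed on [c]. The product [VU] is a weighted cycle, whose weight
    at [j] is the probability of missing [c j]. *)
Lemma cycle_core_gf c : c \in sections ->
  \sum_(f : {ffun T -> T} | graded f && `[< cycle_core c f >]) \prod_v X (f v) =
  (\prod_v fiber_sum (ordS (tg v))) * (\prod_i (X (c i) / fiber_sum i))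
    * (1 - \prod_i (1 - X (c i) / fiber_sum i)).
Proof.
move=> sc; have tc i : tg (c i) = i by apply/eqP; have /familyP/(_ i) := sc.
pose E := fiber_sum.
pose a u w := if (tg w == ordS (tg u)) && (hits c u ==> hits c w) then X w else 0.
transitivity (fdet (fun u v =>
    \sum_w a u w * ((u == v)%:R - (kill c w == Some v)%:R))).
  rewrite (forest_theorem a (fun _ => kill c)) big_mkcond [RHS]big_mkcond /=.
  apply: eq_bigr => f _.
  case: ifPn => [/andP[gf /asboolP[cf acf]] | ncf].
    rewrite ifT; last exact/asboolP.
    apply: eq_bigr => v _; rewrite /a ifT //; apply/andP; split.
      exact: (forallP gf).
    exact/implyP/cf.
  (* A choice function that is not graded, or that leaves [c] from a point of
     [c], uses an arc of weight 0. *)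
  case: asboolP => // acf.
  have [v nv] : exists v,
      ~~ ((tg (f v) == ordS (tg v)) && (hits c v ==> hits c (f v))).
    apply: contrapT => nv.
    have H v : (tg (f v) == ordS (tg v)) && (hits c v ==> hits c (f v)).
      by apply/negPn/negP => nv'; apply: nv; exists v.
    case/negP: ncf; apply/andP; split.
      by apply/forallP => v; have /andP[] := H v.
    by apply/asboolP; split=> // v; have /andP[_ /implyP] := H v.
  by rewrite (bigD1 v) //= /a (negbTE nv) mul0r.
pose d u := \sum_w a u w.
have dE u : d u = E (ordS (tg u)) *
    (if hits c u then X (c (ordS (tg u))) / E (ordS (tg u)) else 1).
  rewrite /d /a -big_mkcond /=; case: (boolP (hits c u)) => cu /=.
    rewrite mulrC divfK // (big_pred1 (c (ordS (tg u)))) // => w /=.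
    rewrite /hits; apply/andP/eqP => [[/eqP <- /eqP->] // | ->].
    by rewrite !tc !eqxx.
  by rewrite mulr1; apply: eq_bigl => w; rewrite andbT.
pose U u i : F := (~~ hits c u && (tg u == i))%:R.
pose V i v := if ~~ hits c v && (tg v == ordS i) then X v / E (tg v) else 0.
transitivity (fdet (fun u v => d u * ((u == v)%:R - \sum_i U u i * V i v))).
  apply: eq_fdet => u v.
  under eq_bigr do rewrite mulrBr.
  rewrite sumrB -mulr_suml mulrBr; congr (_ - _).
  rewrite (bigD1 v) //= [X in _ + X]big1 ?addr0; last first.
    move=> w wv; rewrite /kill; case: ifP => _; rewrite ?mulr0 //.
    by rewrite (inj_eq Some_inj) (negbTE wv) mulr0.
  rewrite (bigD1 (tg u)) //= [X in _ + X]big1 ?addr0; last first.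
    by move=> i /negbTE ui; rewrite /U eq_sym ui andbF mul0r.
  rewrite dE /U /V eqxx andbT /kill /a.
  case: (boolP (hits c u)) => cu; case: (boolP (hits c v)) => cv //=.
  - by rewrite !mulr0.
  - by rewrite andbF !mul0r mulr0.
  - by rewrite !mulr0.
  rewrite eqxx andbT mulr1 mul1r mulr1.
  by case: eqP => [->|_]; rewrite ?mulr0 // mulrC divfK.
rewrite fdet_scale_rows fdet_sylvester; congr (_ * _).
  under eq_bigr do rewrite dE.
  rewrite big_split /= -big_mkcond /=; congr (_ * _).
  rewrite [RHS](reindex _ (onW_bij _ (@ordS_bij k))) /=.
  rewrite (reindex_onto c tg) /=; last by move=> v /eqP.
  by apply: eq_big => [i | i _]; rewrite /hits tc ?eqxx.
rewrite -(fdet_cycle i0); apply: eq_fdet => i j; congr (_ - _).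
have -> : 1 - X (c j) / E j =
    \sum_(u | ~~ hits c u && (tg u == j)) X u / E j.
  have := fiber_sum_neq0 j; rewrite -/(E j) => Ej.
  rewrite -mulr_suml -(divff Ej) -mulrBl; congr (_ / _).
  rewrite /E /fiber_sum (bigD1 (c j)) ?tc //= addrAC subrr add0r.
  apply: eq_bigl => u; rewrite andbC /hits.
  by case: (tg u =P j) => [->|_]; rewrite ?andbF // eq_sym.
rewrite [X in _ = _ * X]big_mkcond mulr_sumr; apply: eq_bigr => u _; rewrite /V /U.
case: (hits c u) => /=; first by rewrite mul0r mulr0.
case: (tg u =P j) => [->|_]; last by rewrite !mulr0.
by rewrite mulr1 eq_sym; case: eqP; rewrite ?mul1r ?mul0r.
Qed.

(** With [y_i] the normalized weight of [c i], summing
    [prod_i y_i - prod_i y_i (1 - y_i)] over sections factors over the fibres,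
    in each of which the normalized weights add up to 1. *)
Lemma ev_const_gf :
  \sum_(f : {ffun T -> T} |
      graded f && `[< exists2 c, c \in sections & ev_const c f >])
    \prod_v X (f v) =
  (\prod_v fiber_sum (ordS (tg v))) *
    (1 - \prod_i (1 - \sum_(v | tg v == i) (X v / fiber_sum i) ^+ 2)).
Proof.
transitivity (\sum_(c in sections)
    \sum_(f : {ffun T -> T} | graded f && `[< cycle_core c f >]) \prod_v X (f v)).
  rewrite (exchange_big_dep (fun f : {ffun T -> T} =>
      graded f && `[< exists2 c, c \in sections & ev_const c f >])) /=.
    apply: eq_bigr => f /andP[gf /asboolP[c sc ec]].
    rewrite (big_pred1 c) // => c' /=; rewrite gf /=.
    apply/andP/eqP => [[sc' /asboolP/(cycle_coreP _ gf) ec'] | ->].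
      exact: ev_const_inj ec' ec.
    by split=> //; apply/asboolP/cycle_coreP.
  move=> c f sc /andP[gf /asboolP cf]; rewrite gf; apply/asboolP.
  by exists c => //; apply/cycle_coreP.
rewrite (eq_bigr _ cycle_core_gf).
under eq_bigr do rewrite -mulrA mulrBr mulr1 -big_split /=.
rewrite -mulr_sumr sumrB; congr (_ * (_ - _)).
  rewrite -(bigA_distr_big_dep _ (fun i v => X v / fiber_sum i)) /=.
  by rewrite big1 // => i _; rewrite -mulr_suml -/(fiber_sum i) divff.
transitivity (\prod_i \sum_(v | tg v == i)
    X v / fiber_sum i * (1 - X v / fiber_sum i)).
  by rewrite bigA_distr_big_dep.
apply: eq_bigr => i _.
under eq_bigr do rewrite mulrBr mulr1 -expr2.
by rewrite sumrB -mulr_suml -/(fiber_sum i) divff.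
Qed.

End GradedMaps.

(** * Representations of the cyclic quiver *)

Section Representations.

Variables (k : nat) (V : 'I_k -> finType).

Definition total_map (W : representation V) : {ffun vertex V -> vertex V} :=
  [ffun v => vert (W (tag v) (tagged v))].

Lemma vert_inj i : injective (@vert k V i).
Proof. by move=> u w /eqP; rewrite /vert eq_Tagged => /eqP. Qed.

Lemma vertK (v : vertex V) i : tag v = i -> exists u : V i, v = vert u.
Proof. by case: v => j u /= <-; exists u. Qed.

Lemma total_map_inj : injective total_map.
Proof.
move=> W W' /ffunP eqW; apply/ffunP => i; apply/ffunP => u.
by have := eqW (vert u); rewrite !ffunE => /vert_inj.
Qed.

Lemma graded_total_map W : graded (@tag _ V) (total_map W).
Proof. by apply/forallP => v; rewrite ffunE. Qed.

Lemma gradedP (f : {ffun vertex V -> vertex V}) :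
  graded (@tag _ V) f -> exists W, f = total_map W.
Proof.
move=> /forallP gf.
have fW i : exists Wi : maps V i, forall u, f (vert u) = vert (Wi u).
  have [g fg] := fin_all_exists (fun u : V i => vertK (eqP (gf (vert u)))).
  by exists (finfun g) => u; rewrite ffunE.
have [W fWi] := fin_all_exists fW.
exists (finfun W); apply/ffunP => -[i u].
by rewrite !ffunE /= -fWi.
Qed.

Lemma vert_cyclic_comp (W : representation V) a l (u : V a) :
  vert (cyclic_comp W l u) = iter l.+1 (total_map W) (vert u).
Proof.
elim: l => [|l IHl]; first by rewrite /= ffunE.
transitivity (total_map W (vert (cyclic_comp W l u))).
  by rewrite ffunE.
by rewrite IHl.
Qed.

Lemma eventually_constantE (W : representation V) :
  eventually_constant W <->
  exists2 c, c \in sections (@tag _ V) & ev_const (@tag _ V) c (total_map W).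
Proof.
split=> [[c [N cN]] | [c /familyP sc [N cN]]].
  exists [ffun i => vert (c i)]; first by apply/familyP => i; rewrite ffunE inE.
  exists N => l le_l [a u]; rewrite /hits ffunE.
  rewrite -[existT _ a u]/(vert u) -vert_cyclic_comp.
  by have [i ->] := cN l le_l a u.
have [c' cc'] := fin_all_exists (fun i => vertK (eqP (sc i))).
exists c', N => l le_l a u; exists (tag (vert (cyclic_comp W l u))).
by rewrite vert_cyclic_comp -cc'; apply/esym/eqP/cN.
Qed.

Lemma target_gf_total_maps (X := fun v : vertex V => 'X_(enum_rank v) : vpoly V) :
  target_gf V =
  \sum_(f : {ffun vertex V -> vertex V} | graded (@tag _ V) f &&
      `[< exists2 c, c \in sections (@tag _ V) & ev_const (@tag _ V) c f >])
    \prod_v X (f v).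
Proof.
transitivity (\sum_(W | `[< eventually_constant W >]) \prod_v X (total_map W v)).
  apply: eq_bigr => W _; rewrite sig_big_dep /=.
  by apply: eq_bigr => v _; rewrite ffunE.
transitivity (\sum_(f in total_map @: [pred W | `[< eventually_constant W >]])
    \prod_v X (f v)).
  by rewrite big_imset //; apply: in2W total_map_inj.
apply: eq_bigl => f.
apply/imsetP/andP => [[W /asboolP ecW ->] | [/gradedP [W ->] /asboolP ecW]].
  by rewrite graded_total_map; split=> //; apply/asboolP/eventually_constantE.
by exists W => //; apply/asboolP/eventually_constantE.
Qed.

Lemma tofrac_natr_neq0 m : m.+1%:R != 0 :> vfrac V.
Proof.
rewrite -(rmorph_nat (@tofrac (vpoly V))) tofrac_eq0.
by rewrite -mpolyC_nat mpolyC_eq0 Num.Theory.pnatr_eq0.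
Qed.

(** Evaluating all variables at 1 gives the size of the fibre. *)
Lemma e1_neq0 i : (0 < #|V i|)%N -> e1 V i != 0.
Proof.
move=> Vi; rewrite /e1 -rmorph_sum tofrac_eq0; apply/eqP.
move/(congr1 (meval (fun _ : 'I_#|vertex V| => 1 : int))).
rewrite meval0 rmorph_sum /=.
under eq_bigr do rewrite mevalXU.
rewrite sumr_const -[_ *+ _]/(#|V i|%:R) => /eqP.
by rewrite Num.Theory.pnatr_eq0 => /eqP V0; rewrite V0 in Vi.
Qed.

(** The normalized identity of [ev_const_gf], with the sums of squares
    eliminated through [2 p2 = p1^2 - sum of squares]. *)
Lemma ev_const_gf_symmetric (F : fieldType) (X : vertex V -> F)
    (p1 := fun i => \sum_(u : V i) X (vert u))
    (p2 := fun i => 2%:R^-1 *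
      \sum_(u : V i) \sum_(w : V i | u != w) X (vert u) * X (vert w)) :
  (0 < k)%N -> 2%:R != 0 :> F -> (forall i, p1 i != 0) ->
  \sum_(f : {ffun vertex V -> vertex V} | graded (@tag _ V) f &&
      `[< exists2 c, c \in sections (@tag _ V) & ev_const (@tag _ V) c f >])
    \prod_v X (f v) =
  tuple_exp p1 (shift_down (sizes V))
  - 2%:R ^+ k * tuple_exp p1 (fun i => shift_down (sizes V) i - 2)
    * tuple_exp p2 (fun=> 1).
Proof.
move=> k_gt0 F2 p1_neq0.
have fiberE (g : vertex V -> F) i :
    \sum_(v | tag v == i) g v = \sum_(u : V i) g (vert u).
  transitivity (\sum_(j | j == i) \sum_(u : V j) g (vert u)).
    by rewrite sig_big_dep; apply: eq_big => [v|[j u] _] //=; rewrite andbT.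
  by rewrite big_pred1_eq.
have E i : fiber_sum (@tag _ V) X i = p1 i by rewrite /fiber_sum fiberE.
have p2E i : 2%:R * p2 i = p1 i ^+ 2 - \sum_(u : V i) X (vert u) ^+ 2.
  rewrite /p2 mulrA divff // mul1r.
  apply/esym/eqP; rewrite subr_eq -big_split /=; apply/eqP.
  rewrite expr2 {1}/p1 mulr_suml; apply: eq_bigr => u _.
  rewrite /p1 mulr_sumr (bigD1 u) //= addrC -expr2; congr (_ + _).
  by apply: eq_bigl => w; rewrite eq_sym.
rewrite (ev_const_gf (Ordinal k_gt0)) => [|i]; last by rewrite E.
rewrite mulrBr mulr1.
have -> : \prod_(v : vertex V) fiber_sum (@tag _ V) X (ordS (tag v)) =
    tuple_exp p1 (shift_down (sizes V)).
  transitivity (\prod_i \prod_(u : V i) p1 (ordS i)).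
    by rewrite sig_big_dep /=; apply: eq_bigr => v _; rewrite E.
  rewrite [RHS](reindex _ (onW_bij _ (@ordS_bij k))).
  by apply: eq_bigr => i _; rewrite prodr_const /shift_down ordSK.
congr (_ - _).
have -> : 2%:R ^+ k = \prod_(i < k) 2%:R :> F by rewrite prodr_const card_ord.
rewrite -mulrA mulrCA /tuple_exp -!big_split /=; apply: eq_bigr => i _.
rewrite expfzDr // expr1z p2E -mulrA; congr (_ * _).
under eq_bigr do rewrite expr_div_n.
rewrite -mulr_suml E fiberE -[p1 i ^ (- 2)]/((p1 i ^+ 2)^-1).
by rewrite mulrC [in RHS]mulrBr mulVf ?expf_neq0 // mulrBl mul1r mulrC.
Qed.

End Representations.

Theorem proposition5p4 (k : nat) (hk : (0 < k)%N) (V : 'I_k -> finType)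
    (hV : forall i : 'I_k, (0 < #|V i|)%N) :
  tofrac (target_gf V) =
    tuple_exp (e1 V) (shift_down (sizes V))
    - 2%:R ^+ k
      * tuple_exp (e1 V) (fun i => shift_down (sizes V) i - 2)
      * tuple_exp (e2 V) (fun=> 1)
  :> vfrac V.
Proof.
rewrite target_gf_total_maps rmorph_sum /=.
under eq_bigr do rewrite rmorph_prod /=.
apply: (ev_const_gf_symmetric (X := fun v => tofrac 'X_(enum_rank v))) => //.
  exact: tofrac_natr_neq0.
by move=> i; apply: e1_neq0.
Qed.
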